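(* Let $\mathcal{A}=\{A_1,\dots,A_m\}$ with $A_i\in\mathbb{R}^{n\times n}$ for $i\in[m]$, and let $H=[A_1,\dots,A_m]\in\mathbb{R}^{n\times nm}$. Then the dynamics $x_{k+1}=A_{\sigma_k}x_k$ (with $x_k\in\mathbb{R}^n$, $\sigma_k\in[m]$, $k\in\mathbb{Z}_{\ge0}$) of the arbitrary switching system $S(\mathcal{A})$ can be written equivalently as $$x(k+1)=H\ltimes\sigma(k)\ltimes x(k),$$ where $x(k)=x_k\in\mathbb{R}^n$ and $\sigma(k)\in\Delta_m$ are the vector forms of the state and the input, respectively.
   Context: Notation: $[m]=\{1,\dots,m\}$. $\delta_m^i$ is the $i$-th column of the identity matrix $I_m$, and $\Delta_m=\{\delta_m^1,\dots,\delta_m^m\}$. $\otimes$ is the Kronecker product. Semi-tensor product (STP): for $A\in\mathbb{R}^{a\times b}$ and $B\in\mathbb{R}^{c\times d}$, $A\ltimes B=(A\otimes I_{s/b})(B\otimes I_{s/c})$, where $s$ is the least common multiple of $b$ and $c$. It is associative. The arbitrary switching system $S(\mathcal{A})$ is the discrete-time switched linear system $x_{k+1}=A_{\sigma_k}x_k$ with no constraint on the switching sequence $\sigma_0\sigma_1\dots$, $\sigma_k\in[m]$. The vector form of $\sigma_k$ is $\sigma(k)=\delta_m^i$ when $\sigma_k=i$, and the vector form of the state is $x(k)=x_k$. *)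

(* Defs.v *)
From mathcomp Require Import all_boot all_order all_algebra.
From mathcomp Require Export reals mxtens.

Set Implicit Arguments.
Unset Strict Implicit.
Unset Printing Implicit Defensive.

Import GRing.Theory.
Local Open Scope ring_scope.

(* The dimensions of a semi-tensor product are arithmetic expressions that equal
   the expected ones only propositionally; [A =mx B] says that the sizes agree
   and that the entries agree. *)
Definition eqmx_dim (R : Type) (m n m' n' : nat)
    (A : 'M[R]_(m, n)) (B : 'M[R]_(m', n')) : Prop :=
  exists e : (m = m') * (n = n'), castmx e A = B.

Notation "A =mx B" := (eqmx_dim A B) (at level 70, no associativity).

Lemma eqmx_dimE (R : Type) (m n : nat) (A B : 'M[R]_(m, n)) :
  A =mx B <-> A = B.
Proof.
split=> [[[em en] <-]|->]; last by exists (erefl, erefl).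
by rewrite (eq_irrelevance em erefl) (eq_irrelevance en erefl).
Qed.

Lemma stp_dim (b c : nat) :
  (c * (lcmn b c %/ c))%N = (b * (lcmn b c %/ b))%N.
Proof. by rewrite ![(_ * (_ %/ _))%N]mulnC !divnK ?dvdn_lcml ?dvdn_lcmr. Qed.

(* [*t] is the Kronecker product; the cast identifies its inner dimensions,
   both equal to [lcmn b c]. *)
Definition stp (R : pzRingType) (a b c d : nat)
    (A : 'M[R]_(a, b)) (B : 'M[R]_(c, d)) :
    'M[R]_(a * (lcmn b c %/ b), d * (lcmn b c %/ c)) :=
  (A *t (1%:M : 'M_(lcmn b c %/ b))) *m
  castmx (stp_dim b c, erefl) (B *t (1%:M : 'M_(lcmn b c %/ c))).

Notation "A ⋉ B" := (stp A B) (at level 40, left associativity).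

Lemma hcat_dim (n m : nat) : (\sum_(i < m) n)%N = (n * m)%N.
Proof. by rewrite sum_nat_const card_ord mulnC. Qed.

Definition hcat (R : Type) (n m : nat) (A : 'I_m -> 'M[R]_n) :
    'M[R]_(n, n * m) :=
  castmx (erefl, hcat_dim n m) (\mxrow_(i < m) A i).

(* Indices run over {0, ..., m-1} rather than {1, ..., m}. *)
Definition dvec (R : pzRingType) (m : nat) (i : 'I_m) : 'cV[R]_m :=
  col i 1%:M.
Arguments dvec R {m} i.

Definition Delta (R : realType) (m : nat) : seq 'cV[R]_m :=
  [seq dvec R i | i : 'I_m].

(* Main.v *)
Require Import Defs.
From mathcomp Require Import all_boot all_order all_algebra.

(** The proof computes [H ⋉ δ_i ⋉ x] and finds [A_i x], for every [i] and [x].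

    When the inner size of the left factor is a multiple [c * t] of the inner
    size [c] of the right factor, the semi-tensor product is an ordinary
    product, [A ⋉ B = A (B ⊗ I_t)] ([stp_mulmx_tens]).  With [t = n] this gives
    [H ⋉ δ_i = H (δ_i ⊗ I_n)], and multiplying by [δ_i ⊗ I_n] extracts the
    [i]-th block of [n] columns of [H], that is [A_i] ([stp_hcat_dvec]).  With
    [t = 1] it gives [A_i ⋉ x = A_i x] ([stp_mulmx]).  So the two recurrences
    have the same right-hand side.  An input sequence with values in [Δ_m] comes
    from a switching sequence because each of its values is some [δ_i].

    The dimensions agree only up to arithmetic identities.  The relation [=mx]
    is therefore handled as a congruence for [⋉] and the other products, so that
    casts can be dropped wherever they occur. *)

Set Implicit Arguments.
Unset Strict Implicit.
Unset Printing Implicit Defensive.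

Import GRing.Theory.
Local Open Scope ring_scope.

Section EqmxDim.
Variable R : Type.

Lemma eqmx_dim_refl m n (A : 'M[R]_(m, n)) : A =mx A.
Proof. exact/eqmx_dimE. Qed.

Lemma eqmx_dim_sym m n m' n' (A : 'M[R]_(m, n)) (B : 'M[R]_(m', n')) :
  A =mx B -> B =mx A.
Proof.
by case=> -[em en] <-; case: _ / em; case: _ / en; apply: eqmx_dim_refl.
Qed.

Lemma eqmx_dim_trans m1 n1 m2 n2 m3 n3 (A : 'M[R]_(m1, n1))
    (B : 'M[R]_(m2, n2)) (C : 'M[R]_(m3, n3)) :
  A =mx B -> B =mx C -> A =mx C.
Proof. by case=> -[em en] <-; case: _ / em; case: _ / en. Qed.

Lemma castmx_eqmx_dim m n m' n' (e : (m = m') * (n = n')) (A : 'M[R]_(m, n)) :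
  castmx e A =mx A.
Proof. by apply: eqmx_dim_sym; exists e. Qed.

End EqmxDim.

Section Congruence.
Variable R : pzRingType.

Lemma eqmx_dim_mulmx m n p m' n' p' (A : 'M[R]_(m, n)) (B : 'M[R]_(n, p))
    (A' : 'M[R]_(m', n')) (B' : 'M[R]_(n', p')) :
  A =mx A' -> B =mx B' -> A *m B =mx A' *m B'.
Proof.
case=> -[em en] <- [[en' ep] <-].
case: _ / em; case: _ / en en' => en'; case: _ / ep.
by rewrite (eq_irrelevance en' erefl); apply: eqmx_dim_refl.
Qed.

Lemma eqmx_dim_stp a b c d a' b' c' d' (A : 'M[R]_(a, b)) (B : 'M[R]_(c, d))
    (A' : 'M[R]_(a', b')) (B' : 'M[R]_(c', d')) :
  A =mx A' -> B =mx B' -> A ⋉ B =mx A' ⋉ B'.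
Proof.
case=> -[ea eb] <- [[ec ed] <-].
by case: _ / ea; case: _ / eb; case: _ / ec; case: _ / ed; apply: eqmx_dim_refl.
Qed.

End Congruence.

Section StpMulmx.
Variable R : comPzRingType.

Lemma tensmx1_eqmx_dim m n (A : 'M[R]_(m, n)) : A *t (1%:M : 'M_1) =mx A.
Proof. by rewrite tens_mx_scalar scale1r; apply: castmx_eqmx_dim. Qed.

(** The quotients of [lcmn b c] occur in the types of the factors, where they
    cannot be rewritten.  With arbitrary [p] and [q] in their place, the two
    equations can be eliminated. *)
Lemma stp_quotients a b c d p q (A : 'M[R]_(a, b)) (B : 'M[R]_(c, d))
    (ep : (lcmn b c %/ b)%N = p) (eqt : (lcmn b c %/ c)%N = q)
    (e : (c * q)%N = (b * p)%N) :
  A ⋉ B =mx (A *t (1%:M : 'M_p)) *m castmx (e, erefl) (B *t (1%:M : 'M_q)).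
Proof.
case: _ / ep e => e; case: _ / eqt e => e.
by rewrite (eq_irrelevance e (stp_dim b c)); apply: eqmx_dim_refl.
Qed.

(** Here [lcmn b c = b], so that the left factor is only tensored with
    [I_1].  The case [b = 0] is excluded because division by [0] returns
    [0]. *)
Lemma stp_mulmx_tens a b c d t (A : 'M[R]_(a, b)) (B : 'M[R]_(c, d))
    (e : b = (c * t)%N) :
  (0 < b)%N ->
  A ⋉ B =mx castmx (erefl, e) A *m (B *t (1%:M : 'M_t)).
Proof.
move=> b_gt0; have lcm_bc : lcmn b c = b.
  by rewrite e; apply/lcmn_idPl; rewrite dvdn_mulr.
have c_gt0 : (0 < c)%N by move: b_gt0; rewrite e; case: (c).
have ep : (lcmn b c %/ b)%N = 1%N by rewrite lcm_bc divnn b_gt0.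
have eqt : (lcmn b c %/ c)%N = t by rewrite lcm_bc e mulKn.
have e' : (c * t)%N = (b * 1)%N by rewrite muln1 e.
apply: eqmx_dim_trans (stp_quotients A B ep eqt e') _.
apply: eqmx_dim_mulmx; last exact: castmx_eqmx_dim.
apply: eqmx_dim_trans (tensmx1_eqmx_dim A) _.
exact/eqmx_dim_sym/castmx_eqmx_dim.
Qed.

Lemma stp_mulmx a b d (A : 'M[R]_(a, b)) (B : 'M[R]_(b, d)) :
  (0 < b)%N -> A ⋉ B =mx A *m B.
Proof.
move=> b_gt0; apply: eqmx_dim_trans (stp_mulmx_tens A B (esym (muln1 b)) b_gt0) _.
by apply: eqmx_dim_mulmx; [apply: castmx_eqmx_dim | apply: tensmx1_eqmx_dim].
Qed.

End StpMulmx.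

(** Column [j] of the [i]-th block is column [i * n + j] of the concatenation.
    This is also the position of the pair [(i, j)] in a Kronecker product of
    sizes [m] and [n]. *)
Lemma hcat_tens_index (R : Type) (n m : nat) (A : 'I_m -> 'M[R]_n)
    (e : (n * m)%N = (m * n)%N) (k : 'I_n) (i : 'I_m) (j : 'I_n) :
  castmx (erefl, e) (hcat A) k (mxtens_index (i, j)) = A i k j.
Proof.
rewrite /hcat castmx_comp castmxE /= cast_ord_id.
set l := cast_ord _ _.
have -> : l = tagnat.Rank (p_ := fun=> n) i j.
  apply: val_inj; rewrite [RHS]tagnat.RankEsum /=; congr (_ + _)%N.
  rewrite -(big_ord_widen m (fun=> n)) ?(ltnW (ltn_ord i)) //.
  by rewrite sum_nat_const card_ord.
by rewrite -[in RHS](mxrowK A i) [RHS]mxE.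
Qed.

Lemma hcat_mulmx_dvec (R : comPzRingType) (n m : nat) (A : 'I_m -> 'M[R]_n)
    (e : (n * m)%N = (m * n)%N) (i : 'I_m) :
  castmx (erefl, e) (hcat A) *m (dvec R i *t (1%:M : 'M_n)) =mx A i.
Proof.
exists (erefl, mul1n n); apply/matrixP=> k j; rewrite castmxE cast_ord_id.
set j' := cast_ord _ _.
have -> : j' = mxtens_index (0, j) by apply: val_inj.
(* The column [(0, j)] of [δ_i ⊗ I_n] has a single nonzero entry, at [(i, j)]. *)
rewrite mxE (bigD1 (mxtens_index (i, j))) //= hcat_tens_index tensmxE.
rewrite !mxE !eqxx !mulr1 big1 ?addr0 // => l.
case: (mxtens_indexP l) => i' k'; rewrite (can_eq (@mxtens_indexK m n)).
rewrite xpair_eqE negb_and hcat_tens_index tensmxE !mxE.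
by case/orP=> /negPf->; rewrite ?mul0r ?mulr0.
Qed.

Lemma stp_hcat_dvec (R : comPzRingType) (n m : nat) (A : 'I_m -> 'M[R]_n)
    (i : 'I_m) :
  (0 < n)%N -> hcat A ⋉ dvec R i =mx A i.
Proof.
move=> n_gt0; have m_gt0 : (0 < m)%N by apply: leq_trans (ltn_ord i).
have nm_gt0 : (0 < n * m)%N by rewrite muln_gt0 n_gt0.
apply: eqmx_dim_trans (stp_mulmx_tens (hcat A) (dvec R i) (mulnC n m) nm_gt0) _.
exact: hcat_mulmx_dvec.
Qed.

Lemma stp_hcat_dvec_mulmx (R : comPzRingType) (n m d : nat)
    (A : 'I_m -> 'M[R]_n) (i : 'I_m) (x : 'M[R]_(n, d)) :
  (0 < n)%N -> hcat A ⋉ dvec R i ⋉ x =mx A i *m x.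
Proof.
move=> n_gt0; apply: eqmx_dim_trans (stp_mulmx (A i) x n_gt0).
exact: eqmx_dim_stp (stp_hcat_dvec A i n_gt0) (eqmx_dim_refl x).
Qed.

Theorem proposition1 (R : realType) (n m : nat) (hn : (0 < n)%N)
    (A : 'I_m -> 'M[R]_n) :
  (forall (sigma : nat -> 'I_m) (x : nat -> 'cV[R]_n) (k : nat),
     x k.+1 = A (sigma k) *m x k <->
     x k.+1 =mx hcat A ⋉ dvec R (sigma k) ⋉ x k)
  /\
  (forall (u : nat -> 'cV[R]_m) (x : nat -> 'cV[R]_n),
     (forall k : nat, u k \in Delta R m) /\
     (forall k : nat, x k.+1 =mx hcat A ⋉ u k ⋉ x k) <->
     exists sigma : nat -> 'I_m,
       (forall k : nat, u k = dvec R (sigma k)) /\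
       (forall k : nat, x k.+1 = A (sigma k) *m x k)).
Proof.
have step (i : 'I_m) (x y : 'cV[R]_n) :
    y = A i *m x <-> y =mx hcat A ⋉ dvec R i ⋉ x.
  have stpE := stp_hcat_dvec_mulmx A i x hn.
  split=> [->|ey]; first exact: eqmx_dim_sym.
  exact/eqmx_dimE/(eqmx_dim_trans ey stpE).
split=> [sigma x k|u x]; first exact: step.
split=> [[u_Delta x_stp]|[sigma [uE xE]]].
  exists (fun k => iinv (u_Delta k)).
  have uE k : u k = dvec R (iinv (u_Delta k)) by rewrite f_iinv.
  by split=> // k; apply/step; rewrite -uE.
split=> k; first by rewrite uE; apply: image_f.
by rewrite uE; apply/step.
Qed.
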